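(* Let $k$ be a field. For each $d \ge 3$, the set of all dynamical degrees of shift-like automorphisms of $\mathbb{A}^3=\mathbb{A}^3_k$ of degree $d$ is strictly contained in the set of all dynamical degrees of affine-triangular automorphisms of $\mathbb{A}^3$ of degree $d$.
   Context: An endomorphism of $\mathbb{A}^n=\mathbb{A}^n_k$ is a tuple $f=(f_1,\ldots,f_n)\in k[x_1,\ldots,x_n]^n$, with composition $(f\circ g)_i=f_i(g_1,\ldots,g_n)$; $f^r$ is the $r$-fold iterate; automorphisms are the invertible endomorphisms. $\deg(f)=\max_i \deg(f_i)$, and for dominant $f$ the dynamical degree is $\lambda(f)=\lim_{r\to\infty}\deg(f^r)^{1/r}$ (the limit exists). A shift-like automorphism of $\mathbb{A}^3$ is one of the form $(x_3+p(x_1,x_2),x_1,x_2)$ with $p\in k[x_1,x_2]$. An affine automorphism is an automorphism of degree $1$; $\tau$ is triangular if $\tau_i\in k[x_1,\ldots,x_i]$ for each $i$. An endomorphism is affine-triangular if it is of the form $\alpha\circ\tau$ with $\alpha$ an affine automorphism and $\tau$ a triangular endomorphism. *)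

(* Defs.v *)
From HB Require Import structures.
From mathcomp Require Import all_boot all_order all_algebra.
From mathcomp Require Import all_classical all_reals all_analysis.
(* The notations of mpoly are incompatible with those of mathcomp-analysis;
   below, [mpoly n k] is {mpoly k[n]}, [mpolyX k (mnm1 i)] is 'X_i and
   [comp_mpoly g p] is p \mPo g. *)
From mathcomp.multinomials Require Import -(notations) mpoly.

Set Implicit Arguments.
Unset Strict Implicit.
Unset Printing Implicit Defensive.

Import Order.TTheory GRing.Theory Num.Theory.
Import numFieldNormedType.Exports.

Local Open Scope classical_set_scope.
Local Open Scope ring_scope.

Section Endomorphisms.
Variables (k : fieldType) (n : nat).

Definition endo := n.-tuple (mpoly n k).

Definition coordinate (i : 'I_n) : mpoly n k := mpolyX k (mnm1 i).

Definition id_endo : endo := [tuple coordinate i | i < n].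

Definition comp_endo (f g : endo) : endo :=
  [tuple comp_mpoly g (tnth f i) | i < n].

Definition iter_endo (f : endo) (r : nat) : endo := iter r (comp_endo f) id_endo.

Definition automorphism (f : endo) : Prop :=
  exists g : endo, comp_endo f g = id_endo /\ comp_endo g f = id_endo.

(* [msize p] is deg p + 1 for p != 0. A zero component is given degree 0 rather
   than -oo, which only affects the degree of the zero tuple. *)
Definition degree (f : endo) : nat := \max_(i < n) (msize (tnth f i)).-1.

Definition dynamical_degree (R : realType) (f : endo) : R :=
  limn (fun r : nat => (degree (iter_endo f r))%:R `^ (r%:R^-1) : R).

(* p lies in the subring k[x_1, ..., x_m] of k[x_1, ..., x_n]; the variables
   are indexed from 0, so these are the variables of index < m. *)
Definition in_first_variables (m : nat) (p : mpoly n k) : Prop :=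
  forall mon : multinom n, mon \in msupp p ->
  forall j : 'I_n, (m <= j)%N -> mon j = 0%N.

Definition triangular (t : endo) : Prop :=
  forall i : 'I_n, in_first_variables i.+1 (tnth t i).

Definition affine_automorphism (a : endo) : Prop :=
  automorphism a /\ degree a = 1%N.

Definition affine_triangular (f : endo) : Prop :=
  exists a t : endo,
    [/\ affine_automorphism a, triangular t & f = comp_endo a t].

End Endomorphisms.

Definition shift_like (k : fieldType) (f : endo k 3) : Prop :=
  let x (i : nat) : mpoly 3 k := coordinate k (inord i) in
  exists p : mpoly 3 k,
    in_first_variables 2 p /\ f = [tuple x 2%N + p; x 0%N; x 1%N].

Definition shift_like_dynamical_degrees
    (R : realType) (k : fieldType) (d : nat) : set R :=
  [set dynamical_degree R f | f in
    [set f : endo k 3 | [/\ automorphism f, shift_like f & degree f = d]]].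

Definition affine_triangular_dynamical_degrees
    (R : realType) (k : fieldType) (d : nat) : set R :=
  [set dynamical_degree R f | f in
    [set f : endo k 3 |
      [/\ automorphism f, affine_triangular f & degree f = d]]].

Arguments shift_like_dynamical_degrees : clear implicits.
Arguments affine_triangular_dynamical_degrees : clear implicits.

(* Main.v *)
(* Write e = d - 1 and let q_c be the positive root of X^2 = e X + c, so that
   q_1 < q_2 < d. The value q_2 is the dynamical degree of the automorphism
   (x_3 + x_1^e x_2, x_2 + x_1^2, x_1): if its r-th iterate has component
   degrees (U, V, W), the next one has degrees (e U + V, 2 U, U), because the
   nonlinear terms always dominate. A shift-like automorphism of degree d never
   has dynamical degree q_2. If x_1^d occurs in p, this monomial dominates and the
   r-th iterate has degree d^r. Otherwise each component degree of the iterates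
   is at most e times the previous one plus the one before that, which bounds
   the dynamical degree by q_1. *)
Require Import Defs.
From mathcomp Require Import all_boot all_order all_algebra.
From mathcomp Require Import all_classical all_reals all_analysis.
From mathcomp Require Import zify ring lra.
From mathcomp.multinomials Require Import -(notations) mpoly.

Set Implicit Arguments.
Unset Strict Implicit.
Unset Printing Implicit Defensive.

Import Order.TTheory GRing.Theory Num.Theory.
Import numFieldNormedType.Exports.

Local Open Scope classical_set_scope.
Local Open Scope ring_scope.

(** * Limits of r-th roots of sequences of exponential growth *)

Section RootLimits.
Variable R : realType.

Lemma cvg_root_cst (C : R) : 0 < C ->
  (fun r : nat => C `^ (r%:R^-1)) @ \oo --> (1 : R).
Proof.
(* Shifting the index discards r = 0 and turns the exponent into the harmonic sequence, so that
   C^(1/(n+1)) = exp(ln C / (n+1)) tends to exp 0. *)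
move=> C0; rewrite -cvg_shiftS /=.
rewrite (_ : (fun n => _) = (fun n : nat => expR (n.+1%:R^-1 * ln C))); last first.
  by apply/funext => n; rewrite /powR gt_eqF.
suff : (fun n : nat => expR (n.+1%:R^-1 * ln C)) @ \oo --> expR (0 * ln C).
  by rewrite mul0r expR0.
apply: continuous_cvg; first exact: continuous_expR.
by apply: cvgM; [exact: cvg_harmonic | exact: cvg_cst].
Qed.

(** The index is [r.+1] because at index 0 the inverse of 0 is 0 and both roots become 1, which
    would force m = 1. *)
Lemma root_exp (C m : R) (r : nat) : 0 <= C -> 0 <= m ->
  (C * m ^+ r.+1) `^ (r.+1%:R^-1) = C `^ (r.+1%:R^-1) * m.
Proof.
move=> C0 m0; rewrite powRM// ?exprn_ge0//; congr (_ * _).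
by rewrite -powR_mulrn// -powRrM mulfV ?pnatr_eq0// powRr1.
Qed.

Lemma cvg_root_exp (C m : R) : 0 < C -> 0 <= m ->
  (fun r : nat => (C * m ^+ r) `^ (r%:R^-1)) @ \oo --> m.
Proof.
move=> C0 m0; rewrite -cvg_shiftS /=.
rewrite (_ : (fun n => _) = (fun n : nat => C `^ n.+1%:R^-1 * m)); last first.
  by apply/funext => n; rewrite (root_exp _ (ltW C0) m0).
suff : (fun n : nat => C `^ n.+1%:R^-1 * m) @ \oo --> 1 * m by rewrite mul1r.
apply: cvgM; last exact: cvg_cst.
by have := cvg_root_cst C0; rewrite -cvg_shiftS.
Qed.

Lemma le_root (x y : R) (r : nat) : 0 <= x -> x <= y ->
  x `^ (r%:R^-1) <= y `^ (r%:R^-1).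
Proof.
move=> x0 xy; apply: ge0_ler_powR => //; rewrite nnegrE// ?invr_ge0//.
exact: le_trans xy.
Qed.

(* The limit of a divergent sequence is the default point of [R], namely 0. *)
Lemma limn_root_le (u : nat -> R) (C m : R) : 0 < C -> 0 <= m ->
  (forall r, 0 <= u r <= C * m ^+ r) ->
  limn (fun r : nat => u r `^ (r%:R^-1)) <= m.
Proof.
move=> C0 m0 u_le.
have [cu|/dvgP ->//] := pselect (cvgn (fun r : nat => u r `^ (r%:R^-1))).
have cm := cvg_root_exp C0 m0.
rewrite -[leRHS](cvg_lim _ cm)//; apply: ler_lim => //.
  by apply: cvgP cm.
by near=> r; have /andP[? ?] := u_le r; exact: le_root.
Unshelve. all: by end_near. Qed.

(** The r-th roots of both bounds tend to m whatever C is, so the squeeze gives convergence together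
    with the value. *)
Lemma limn_root_eq (u : nat -> R) (C m : R) : 0 < C -> 0 <= m ->
  (forall r, m ^+ r <= u r <= C * m ^+ r) ->
  limn (fun r : nat => u r `^ (r%:R^-1)) = m.
Proof.
move=> C0 m0 u_le; apply: cvg_lim => //.
apply: (@squeeze_cvgr _ _ _ _ (fun r : nat => (1 * m ^+ r) `^ (r%:R^-1))
          (fun r : nat => (C * m ^+ r) `^ (r%:R^-1))).
- near=> r; have /andP[lo hi] := u_le r; rewrite mul1r.
  have := exprn_ge0 r m0 => mr0.
  by rewrite !le_root//; apply: le_trans lo.
- exact: cvg_root_exp.
- exact: cvg_root_exp.
Unshelve. all: by end_near. Qed.

End RootLimits.

(** * Total degree of sums, products and compositions *)

Section TotalDegree.
Variables (k : fieldType) (n : nat).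
Implicit Types p q : mpoly n k.

(** The zero polynomial gets degree 0, in agreement with [degree]. *)
Definition tdeg p : nat := (msize p).-1.

Lemma tdegD_le p q : (tdeg (p + q)%R <= maxn (tdeg p) (tdeg q))%N.
Proof. by have := mmeasureD_le mdeg p q; rewrite /tdeg; lia. Qed.

Lemma tdegN p : tdeg (- p) = tdeg p.
Proof. by rewrite /tdeg mmeasureN. Qed.

(** Writing p = (p + q) - q bounds deg p by the maximum of deg (p + q) and deg q, and the latter is
    too small. *)
Lemma tdegDl p q : (tdeg q < tdeg p)%N -> tdeg (p + q) = tdeg p.
Proof.
move=> qp; have := tdegD_le p q; have := tdegD_le (p + q) (- q).
by rewrite addrK tdegN; lia.
Qed.

Lemma tdeg_addr_lt p q :
  (tdeg q < tdeg (p + q)%R)%N -> tdeg p = tdeg (p + q).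
Proof. by move=> pq; rewrite -(@tdegDl (p + q) (- q)) ?tdegN// addrK. Qed.

Lemma tdeg_neq0 p : (0 < tdeg p)%N -> p != 0.
Proof. by apply: contraTneq => ->; rewrite /tdeg mmeasure0. Qed.

Lemma tdegM p q : p != 0 -> q != 0 -> tdeg (p * q) = (tdeg p + tdeg q)%N.
Proof.
move=> p0 q0; rewrite /tdeg msizeM//.
move: p0 q0; rewrite -!(mmeasure_poly_eq0 mdeg).
by case: (msize p) => // a; case: (msize q) => // b _ _; rewrite addSn addnS.
Qed.

Lemma tdegM_le p q : (tdeg (p * q)%R <= tdeg p + tdeg q)%N.
Proof.
have [->|p0] := eqVneq p 0; first by rewrite mul0r /tdeg mmeasure0.
have [->|q0] := eqVneq q 0; first by rewrite mulr0 /tdeg mmeasure0.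
by rewrite tdegM.
Qed.

Lemma tdegXn p m : tdeg (p ^+ m) = (m * tdeg p)%N.
Proof.
have [->|p0] := eqVneq p 0.
  by case: m => [|m]; rewrite ?expr0 ?exprS ?mul0r /tdeg ?mmeasure0 ?msize1 ?muln0.
elim: m => [|m IH]; first by rewrite expr0 /tdeg msize1.
by rewrite exprS tdegM ?expf_neq0// IH mulSn.
Qed.

Lemma tdegZ_le (c : k) p : (tdeg (c *: p)%R <= tdeg p)%N.
Proof. by rewrite /tdeg -!subn1 leq_sub2r// msizeZ_le. Qed.

Lemma tdeg_coordinate (i : 'I_n) : tdeg (coordinate k i) = 1%N.
Proof. by rewrite /tdeg msizeX mdeg1. Qed.

Lemma tdeg_sum_le (I : eqType) (r : seq I) (F : I -> mpoly n k) (N : nat) :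
  (forall i, i \in r -> (tdeg (F i) <= N)%N) ->
  (tdeg (\sum_(i <- r) F i)%R <= N)%N.
Proof.
elim: r => [|i r IH] FN; first by rewrite big_nil /tdeg mmeasure0.
rewrite big_cons; apply: leq_trans (tdegD_le _ _) _.
rewrite geq_max FN ?mem_head//= IH// => j jr.
by rewrite FN// in_cons jr orbT.
Qed.

Lemma tdeg_prod_le (I : Type) (r : seq I) (F : I -> mpoly n k) :
  (tdeg (\prod_(i <- r) F i)%R <= \sum_(i <- r) tdeg (F i))%N.
Proof.
elim: r => [|i r IH]; first by rewrite !big_nil /tdeg msize1.
rewrite !big_cons; apply: leq_trans (tdegM_le _ _) _.
by rewrite leq_add2l.
Qed.

End TotalDegree.

(** The composition is the sum of the terms of p evaluated at g, and cancellation can only lower the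
    degree. *)
Lemma tdeg_comp_le (k : fieldType) (m n : nat) (p : mpoly m k)
    (g : m.-tuple (mpoly n k)) (N : nat) :
  (forall mon : multinom m, mon \in msupp p ->
     (\sum_(i < m) mon i * tdeg (tnth g i) <= N)%N) ->
  (tdeg (comp_mpoly g p) <= N)%N.
Proof.
move=> pN; rewrite comp_mpolyEX; apply: tdeg_sum_le => mon /pN.
apply: leq_trans; apply: leq_trans (tdegZ_le _ _) _.
rewrite comp_mpolyX; apply: leq_trans (tdeg_prod_le _ _) _.
by apply: leq_sum => i _; rewrite tdegXn.
Qed.

(** * Substitution into coordinates, products and powers *)

Section CompMpoly.
Variables (k : fieldType) (m n : nat) (g : m.-tuple (mpoly n k)).

Lemma comp_coordinate i : comp_mpoly g (coordinate k i) = tnth g i.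
Proof. by rewrite /coordinate comp_mpolyXU -tnth_nth. Qed.

Lemma comp_mpolyM p q :
  comp_mpoly g (p * q) = comp_mpoly g p * comp_mpoly g q.
Proof. exact: (rmorphM (comp_mpoly g)). Qed.

Lemma comp_mpolyXn p r : comp_mpoly g (p ^+ r) = comp_mpoly g p ^+ r.
Proof. exact: (rmorphXn (comp_mpoly g)). Qed.

End CompMpoly.

(** * Closure properties of the subring of polynomials in the first m variables *)

Section FirstVariables.
Variables (k : fieldType) (n : nat).
Implicit Types p q : mpoly n k.

Lemma in_first_variables_coordinate (m : nat) (i : 'I_n) : (i < m)%N ->
  in_first_variables m (coordinate k i).
Proof.
move=> im mon; rewrite msuppX inE => /eqP -> j mj.
by rewrite mnm1E; case: eqVneq => // ij; move: mj; rewrite -ij leqNgt im.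
Qed.

Lemma in_first_variablesD m p q : in_first_variables m p ->
  in_first_variables m q -> in_first_variables m (p + q).
Proof.
by move=> pm qm mon /msuppD_le; rewrite mem_cat => /orP[/pm|/qm].
Qed.

Lemma in_first_variablesM m p q : in_first_variables m p ->
  in_first_variables m q -> in_first_variables m (p * q).
Proof.
move=> pm qm mon /msuppM_le /allpairsP[[a b]/= [/pm ap /qm bq ->]] j mj.
by rewrite mnmDE ap// bq.
Qed.

Lemma in_first_variablesX m p (r : nat) :
  in_first_variables m p -> in_first_variables m (p ^+ r).
Proof.
move=> pm; elim: r => [|r IHr]; last by rewrite exprS; exact: in_first_variablesM.
by move=> mon; rewrite expr0 msupp1 inE => /eqP -> j _; rewrite mnm0E.
Qed.

End FirstVariables.

(** * Endomorphisms of affine 3-space as explicit triples *)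

Section Endo3.
Variable k : fieldType.
Local Notation x i := (coordinate k (inord i : 'I_3)).

(** Indices take the form [inord i] to match the coordinates in [shift_like]. *)
Lemma ord3_ind (P : 'I_3 -> Prop) :
  P (inord 0) -> P (inord 1) -> P (inord 2) -> forall i, P i.
Proof.
move=> P0 P1 P2 [[|[|[|//]]] hi].
- by rewrite (_ : Ordinal hi = inord 0)//; apply/val_inj; rewrite /= inordK.
- by rewrite (_ : Ordinal hi = inord 1)//; apply/val_inj; rewrite /= inordK.
- by rewrite (_ : Ordinal hi = inord 2)//; apply/val_inj; rewrite /= inordK.
Qed.

Lemma tnth3 (T : Type) (a b c : T) :
  (tnth [tuple a; b; c] (inord 0) = a) * (tnth [tuple a; b; c] (inord 1) = b) *
  (tnth [tuple a; b; c] (inord 2) = c).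
Proof. by do !split; rewrite (tnth_nth a) inordK. Qed.

Lemma big3 (T : Type) (idx : T) (op : Monoid.law idx) (F : 'I_3 -> T) :
  \big[op/idx]_(i < 3) F i = op (F (inord 0)) (op (F (inord 1)) (F (inord 2))).
Proof.
rewrite !big_ord_recl big_ord0 Monoid.mulm1.
by congr (op (F _) (op (F _) (F _))); apply/val_inj; rewrite /= inordK.
Qed.

Lemma comp_endo3 (a b c : mpoly 3 k) (g : endo k 3) :
  comp_endo [tuple a; b; c] g =
  [tuple comp_mpoly g a; comp_mpoly g b; comp_mpoly g c].
Proof.
by apply: eq_from_tnth; apply: ord3_ind; rewrite tnth_mktuple !tnth3.
Qed.

Lemma id_endo3 : id_endo k 3 = [tuple x 0%N; x 1%N; x 2%N].
Proof.
by apply: eq_from_tnth; apply: ord3_ind; rewrite tnth_mktuple !tnth3.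
Qed.

Lemma degree3 (a b c : mpoly 3 k) :
  degree [tuple a; b; c] = maxn (tdeg a) (maxn (tdeg b) (tdeg c)).
Proof. by rewrite /degree big3 !tnth3. Qed.

End Endo3.

(** * Degree growth of shift-like endomorphisms *)

Section ShiftLike.
Variables (R : realType) (k : fieldType).
Local Notation x i := (coordinate k (inord i : 'I_3)).

Variables (p : mpoly 3 k) (e : nat).
Local Notation f := ([tuple x 2 + p; x 0; x 1] : endo k 3).
(** The exponent of the monomial x_1^d, with d = e + 1 and variables indexed from 0. *)
Local Notation x0d := (mnm_muln (mnm1 (inord 0 : 'I_3)) e.+1).

Lemma comp_shift_like (u v w : mpoly 3 k) :
  comp_endo f [tuple u; v; w] =
  [tuple w + comp_mpoly [tuple u; v; w] p; u; v].
Proof. by rewrite comp_endo3 raddfD/= !comp_coordinate !tnth3. Qed.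

Hypothesis p_vars : in_first_variables 2 p.
Hypothesis p_deg : tdeg p = e.+1.

Lemma shift_like_mon_bound (mon : multinom 3) :
    mon \in msupp p -> mon != x0d ->
  [/\ (mon (inord 0) <= e)%N, (mon (inord 0) + mon (inord 1) <= e.+1)%N
    & mon (inord 2) = 0%N].
Proof.
move=> pmon monN.
have mon2 : mon (inord 2) = 0%N by apply: (p_vars pmon); rewrite inordK.
have mdeg_le : (mon (inord 0) + mon (inord 1) <= e.+1)%N.
  have := msize_mdeg_lt pmon; rewrite mdegE big3 /= mon2 addn0.
  by move: p_deg; rewrite /tdeg; case: (msize p) => // ? /= ->.
(* An exponent of x_1 above e exhausts the total degree e + 1, so the monomial would be x_1^d. *)
split=> //; rewrite leqNgt; apply: contra monN => mon0.
have [mon0E mon1E] : mon (inord 0) = e.+1 /\ mon (inord 1) = 0%N by lia.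
apply/eqP/mnmP; apply: ord3_ind; rewrite mulmnE mnm1E;
  rewrite ?mon0E ?mon1E ?mon2 -val_eqE /= !inordK//; lia.
Qed.

(** The maximum makes the bound valid without comparing the degrees of u and v. *)
Lemma shift_like_mon_tdeg (mon : multinom 3) (u v w : mpoly 3 k) :
    mon \in msupp p -> mon != x0d ->
  (\sum_(i < 3) mon i * tdeg (tnth [tuple u; v; w] i) <=
   e * maxn (tdeg u) (tdeg v) + tdeg v)%N.
Proof.
move=> pmon monN; have [mon0 mon01 mon2] := shift_like_mon_bound pmon monN.
rewrite big3 /= !tnth3 mon2 mul0n addn0.
move: (mon (inord 0)) (mon (inord 1)) mon0 mon01 => i j ie ij.
move: (tdeg u) (tdeg v) => a b.
have aM : (a <= maxn a b)%N by lia.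
have bM : (b <= maxn a b)%N by lia.
move: (maxn a b) aM bM => M aM bM.
(* If j = 0, then i a <= e M. Otherwise one factor of degree b is set aside, and the remaining i + j
   - 1 <= e factors (in the original j) have degree at most M each. *)
case: j ij => [|j] ij; first by nia.
by nia.
Qed.

Lemma shift_like_degree_le (m : R) (r : nat) : x0d \notin msupp p ->
    1 <= m -> m ^+ 2 = e%:R * m + 1 ->
  (degree (iter_endo f r))%:R <= m * m ^+ r.
Proof.
move=> x0dp m1 mE.
(* The bound m^r on deg w, rather than m^(r-1), leaves room for w = x_3 at r = 0. *)
suff [u [v [w [-> uB vB wB]]]] : exists u v w, [/\ iter_endo f r = [tuple u; v; w],
    (tdeg u)%:R <= m ^+ r.+1, (tdeg v)%:R <= m ^+ r & (tdeg w)%:R <= m ^+ r].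
  have mr : m ^+ r <= m ^+ r.+1 by rewrite ler_weXn2l.
  rewrite degree3 -exprS -!maxEnat !natr_max !ge_max uB/=.
  by rewrite (le_trans vB) ?(le_trans wB).
elim: r => [|r [u [v [w [IHr uB vB wB]]]]].
  exists (x 0), (x 1), (x 2); rewrite !tdeg_coordinate expr1 expr0; split=> //.
  exact: id_endo3.
have mr : m ^+ r <= m ^+ r.+1 by rewrite ler_weXn2l.
have mr0 : 0 <= m ^+ r by rewrite exprn_ge0// (le_trans _ m1).
(* By the equation for m, its powers satisfy the recurrence of the degree bounds with equality. *)
have mrE : m ^+ r.+2 = e%:R * m ^+ r.+1 + m ^+ r.
  by rewrite -addn2 exprD mE exprS; ring.
exists (w + comp_mpoly [tuple u; v; w] p), u, v; split=> //.
- by rewrite /iter_endo iterS -/(iter_endo f r) IHr comp_shift_like.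
- have degN := @tdeg_comp_le k 3 3 p [tuple u; v; w] _ (fun mon pmon =>
    @shift_like_mon_tdeg mon u v w pmon (memPn x0dp mon pmon)).
  have := tdegD_le w (comp_mpoly [tuple u; v; w] p).
  rewrite leq_max => /orP[wD|pD].
    rewrite (le_trans (_ : _ <= (tdeg w)%:R)) ?ler_nat// (le_trans wB)//.
    by rewrite ler_weXn2l//; lia.
  have {}degN := leq_trans pD degN.
  rewrite (le_trans (_ : _ <= (e * maxn (tdeg u) (tdeg v) + tdeg v)%:R)) ?ler_nat//.
  by rewrite natrD natrM mrE lerD// ler_wpM2l// -maxEnat natr_max ge_max uB (le_trans vB).
- exact: le_trans mr.
Qed.

Lemma shift_like_degree_eq (r : nat) : (0 < e)%N -> x0d \in msupp p ->
  degree (iter_endo f r) = (e.+1 ^ r)%N.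
Proof.
move=> e0 x0dp.
(* At r = 0 all three components have degree 1, so the strict inequalities of the invariant start
   only at r = 1. *)
case: r => [|r]; first by rewrite /iter_endo /= id_endo3 degree3 !tdeg_coordinate.
suff [u [v [w [-> uE vB wB]]]] : exists u v w,
  [/\ iter_endo f r.+1 = [tuple u; v; w], tdeg u = (e.+1 ^ r.+1)%N,
     (tdeg v < tdeg u)%N & (tdeg w < tdeg u)%N].
  by rewrite degree3 -uE; lia.
elim: r => [|r [u [v [w [IHr uE vB wB]]]]].
  exists (x 2 + p), (x 0), (x 1).
  have -> : tdeg (x 2 + p) = e.+1.
    by rewrite addrC tdegDl p_deg// tdeg_coordinate ltnS.
  rewrite !tdeg_coordinate expn1; split=> //.
  by rewrite /iter_endo /= id_endo3 comp_shift_like -id_endo3 comp_mpoly_id.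
exists (w + comp_mpoly [tuple u; v; w] p), u, v.
(* The term of x_1^d contributes degree (e + 1) deg u. Every other term has degree at most e deg u +
   deg v, which is smaller because deg v < deg u. *)
have pE : tdeg (comp_mpoly [tuple u; v; w] p) = (e.+1 * tdeg u)%N.
  rewrite comp_mpolyEX (big_rem _ x0dp)/=.
  have leadE : tdeg (mcoeff x0d p *: comp_mpoly [tuple u; v; w] (mpolyX k x0d))
      = (e.+1 * tdeg u)%N.
    rewrite comp_mpolyX big3 !tnth3 !mulmnE !mnm1E -!val_eqE /= !inordK//=.
    rewrite mul1n !mul0n !expr0 !mulr1 -tdegXn /tdeg msizeZ//.
    by rewrite -mcoeff_msupp.
  rewrite tdegDl leadE//.
  apply: (@leq_ltn_trans (e * maxn (tdeg u) (tdeg v) + tdeg v)); last first.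
    by rewrite (maxn_idPl (ltnW vB)) mulSn addnC ltn_add2r.
  apply: tdeg_sum_le => mon.
  rewrite (mem_rem_uniq _ (msupp_uniq _)) inE => /andP[monN pmon].
  apply: leq_trans (tdegZ_le _ _) _; rewrite comp_mpolyX.
  apply: leq_trans (tdeg_prod_le _ _) _.
  under eq_bigr do rewrite tdegXn.
  exact: shift_like_mon_tdeg.
have -> : tdeg (w + comp_mpoly [tuple u; v; w] p) = (e.+1 * tdeg u)%N.
  by rewrite addrC tdegDl pE// (leq_trans wB)// leq_pmull.
split.
- by rewrite /iter_endo iterS -/(iter_endo f r.+1) IHr comp_shift_like.
- by rewrite uE -expnS.
- by rewrite ltn_Pmull ?ltnS// uE expn_gt0.
- by rewrite (ltn_trans vB)// ltn_Pmull ?ltnS// uE expn_gt0.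
Qed.

End ShiftLike.

(** * An affine-triangular automorphism with degree growth governed by q_2 *)

Section Example.
Variables (R : realType) (k : fieldType) (e : nat).
Local Notation x i := (coordinate k (inord i : 'I_3)).

Definition gap_endo : endo k 3 :=
  [tuple x 2 + x 0 ^+ e * x 1; x 1 + x 0 ^+ 2; x 0].

Lemma comp_gap_endo (u v w : mpoly 3 k) :
  comp_endo gap_endo [tuple u; v; w] =
  [tuple w + u ^+ e * v; v + u ^+ 2; u].
Proof.
by rewrite comp_endo3 !comp_mpolyD comp_mpolyM !comp_mpolyXn !comp_coordinate !tnth3.
Qed.

Lemma automorphism_gap_endo : automorphism gap_endo.
Proof.
(* The inverse is found from the last component upwards: it gives x_1, then the second gives x_2,
   then the first gives x_3. *)
exists [tuple x 2; x 1 - x 2 ^+ 2; x 0 - x 2 ^+ e * (x 1 - x 2 ^+ 2)]; split.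
  by rewrite comp_gap_endo id_endo3 !subrK.
rewrite comp_endo3 !comp_mpolyB comp_mpolyM comp_mpolyB !comp_mpolyXn.
by rewrite !comp_coordinate !tnth3 !addrK id_endo3.
Qed.

Lemma affine_automorphism_rev : affine_automorphism [tuple x 2; x 1; x 0].
Proof.
split; last by rewrite degree3 !tdeg_coordinate.
by exists [tuple x 2; x 1; x 0]; rewrite comp_endo3 !comp_coordinate !tnth3 id_endo3.
Qed.

Lemma affine_triangular_gap_endo : affine_triangular gap_endo.
Proof.
exists [tuple x 2; x 1; x 0], [tuple x 0; x 1 + x 0 ^+ 2; x 2 + x 0 ^+ e * x 1].
split.
- exact: affine_automorphism_rev.
- apply: ord3_ind; rewrite tnth3;
    repeat first [ apply: in_first_variablesD | apply: in_first_variablesM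
                 | apply: in_first_variablesX
                 | by apply: in_first_variables_coordinate; rewrite !inordK ].
- by rewrite comp_endo3 !comp_coordinate !tnth3.
Qed.

Hypothesis e2 : (2 <= e)%N.

(** The degree map (U, V) -> (e U + V, 2 U) has eigenvector (1, 2/m) for the eigenvalue m. The
    degrees are kept between m^r and (e + 1) m^r times this vector; the bounds on V are multiplied
    by m to avoid division. *)
Lemma degree_gap_endo_bounds (m : R) (r : nat) :
    1 <= m <= e.+1%:R -> 2 <= m -> m ^+ 2 = e%:R * m + 2 ->
  m ^+ r <= (degree (iter_endo gap_endo r))%:R <= (2 * e.+1)%:R * m ^+ r.
Proof.
move=> /andP[m1 me] m2 mE.
(* With a = deg u and b = deg v, the condition b < 2 a makes u^2 dominate v, and deg w <= deg u
   makes u^e v dominate w; both persist under iteration. *)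
have step (a b : nat) : (0 < a)%N -> (0 < b)%N -> (b < 2 * a)%N ->
  [/\ (0 < e * a + b)%N, (0 < 2 * a)%N, (a < e * a + b)%N
    & (2 * a < 2 * (e * a + b))%N].
  by move=> *; split; nia.
suff [u [v [w [[-> u0 v0] [wu vu] [ulo vlo] [uhi vhi]]]]] : exists u v w,
  [/\ [/\ iter_endo gap_endo r = [tuple u; v; w], (0 < tdeg u)%N & (0 < tdeg v)%N],
     (tdeg w <= tdeg u)%N /\ (tdeg v < 2 * tdeg u)%N,
     m ^+ r <= (tdeg u)%:R /\ 2 * m ^+ r <= m * (tdeg v)%:R &
     (tdeg u)%:R <= e.+1%:R * m ^+ r /\
     m * (tdeg v)%:R <= 2 * e.+1%:R * m ^+ r].
  rewrite degree3; apply/andP; split.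
    by apply: le_trans ulo _; rewrite ler_nat; lia.
  apply: (@le_trans _ _ (2 * tdeg u)%:R); first by rewrite ler_nat; lia.
  by rewrite !natrM -mulrA ler_pM2l.
elim: r => [|r [u [v [w [[IHr u0 v0] [wu vu] [ulo vlo] [uhi vhi]]]]]].
  (* All degrees are 1 here: the lower bound on V is 2 <= m, and the upper one follows from m <= e +
     1. *)
  exists (x 0), (x 1), (x 2); rewrite !tdeg_coordinate expr0 !mulr1.
  split; split=> //; first exact: id_endo3.
    by rewrite ler1n.
  by apply: le_trans me _; rewrite ler_peMl// ler1n.
exists (w + u ^+ e * v), (v + u ^+ 2), u.
have [U_gt0 V_gt0 WU VU] := step _ _ u0 v0 vu.
have vE : tdeg (v + u ^+ 2) = (2 * tdeg u)%N.
  by rewrite addrC tdegDl tdegXn.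
have uvE : tdeg (u ^+ e * v) = (e * tdeg u + tdeg v)%N.
  by rewrite tdegM ?expf_neq0 ?tdeg_neq0// tdegXn.
have uE : tdeg (w + u ^+ e * v) = (e * tdeg u + tdeg v)%N.
  by rewrite addrC tdegDl uvE// (leq_ltn_trans wu).
have m_gt0 : 0 < m by lra.
(* After multiplication by m, the new bounds on U become e m times the old bound on U plus the old
   bound on m V. *)
have mS : m * m ^+ r.+1 = (e%:R * m + 2) * m ^+ r by rewrite -mE !exprS; ring.
have em0 : 0 <= e%:R * m :> R by rewrite mulr_ge0// ltW.
rewrite uE vE natrD !natrM.
split; split=> //; try exact: ltnW.
- by rewrite /iter_endo iterS -/(iter_endo gap_endo r) IHr comp_gap_endo.
- rewrite -(ler_pM2l m_gt0) mS.
  by have := ler_wpM2l em0 ulo; lra.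
- by rewrite exprS; have := ler_wpM2l (ltW m_gt0) ulo; lra.
- rewrite -(ler_pM2l m_gt0) [leRHS]mulrCA mS.
  by have := ler_wpM2l em0 uhi; lra.
- by rewrite exprS; have := ler_wpM2l (ltW m_gt0) uhi; lra.
Qed.

Lemma degree_gap_endo : degree gap_endo = e.+1.
Proof.
rewrite degree3 tdeg_coordinate.
have xN0 i : x i != 0 by apply: tdeg_neq0; rewrite tdeg_coordinate.
have -> : tdeg (x 1 + x 0 ^+ 2) = 2%N.
  by rewrite addrC tdegDl tdegXn !tdeg_coordinate.
have xyE : tdeg (x 0 ^+ e * x 1) = e.+1.
  by rewrite tdegM ?expf_neq0// tdegXn !tdeg_coordinate; lia.
by rewrite addrC tdegDl xyE ?tdeg_coordinate; lia.
Qed.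

End Example.

(** * The roots q_c and their order *)

(** This is q_c, the larger root of X^2 = e X + c. *)
Definition quadratic_root (R : realType) (e c : nat) : R :=
  (e%:R + Num.sqrt (e%:R ^+ 2 + 4 * c%:R)) / 2.

Lemma quadratic_rootE (R : realType) (e c : nat) :
  quadratic_root R e c ^+ 2 = e%:R * quadratic_root R e c + c%:R.
Proof.
have D0 : 0 <= e%:R ^+ 2 + 4 * c%:R :> R by rewrite addr_ge0 ?exprn_ge0 ?mulr_ge0.
by have := sqr_sqrtr D0; rewrite /quadratic_root => sE; field: sE.
Qed.

Lemma quadratic_root_ge (R : realType) (e c : nat) :
  e%:R <= quadratic_root R e c.
Proof.
have e0 : 0 <= e%:R :> R by [].
suff : e%:R <= Num.sqrt (e%:R ^+ 2 + 4 * c%:R) :> R by rewrite /quadratic_root; lra.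
by rewrite -[leLHS]ger0_norm// -sqrtr_sqr ler_wsqrtr// lerDl mulr_ge0.
Qed.

(** If q_c were at least e + 1, then c = q_c (q_c - e) would be at least e + 1. *)
Lemma quadratic_root_lt (R : realType) (e c : nat) : (c <= e)%N ->
  quadratic_root R e c < e.+1%:R.
Proof.
rewrite -(ler_nat R) -natr1 => ce.
have := quadratic_root_ge R e c; have := quadratic_rootE R e c.
have : 0 <= e%:R :> R by [].
by move: (quadratic_root R e c) (e%:R) (c%:R) ce => m a b *; nra.
Qed.

Lemma ltr_quadratic_root (R : realType) (e c c' : nat) : (c < c')%N ->
  quadratic_root R e c < quadratic_root R e c'.
Proof.
move=> cc'; rewrite /quadratic_root ltr_pM2r ?invr_gt0// ltrD2l ltr_sqrt.
  by rewrite ltrD2l ltr_pM2l// ltr_nat.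
by rewrite ltr_wpDl ?exprn_ge0// mulr_gt0// ltr0n; case: c' cc'.
Qed.

(** * Comparison of the two sets of dynamical degrees *)

Lemma shift_like_affine_triangular (k : fieldType) (f : endo k 3) :
  shift_like f -> affine_triangular f.
Proof.
move=> [p [p_vars ->]] /=; pose x i := coordinate k (inord i : 'I_3).
(* The triangular map adds p to x_3, and a cyclic permutation of the coordinates follows. *)
exists [tuple x 2; x 0; x 1], [tuple x 0; x 1; x 2 + p]; split.
- split; last by rewrite degree3 !tdeg_coordinate.
  by exists [tuple x 1; x 2; x 0]; rewrite !comp_endo3 !comp_coordinate !tnth3 id_endo3.
- apply: ord3_ind; rewrite tnth3;
    try by apply: in_first_variables_coordinate; rewrite !inordK.
  apply: in_first_variablesD.
    by apply: in_first_variables_coordinate; rewrite !inordK.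
  by move=> mon pmon j; rewrite !inordK// => j3; apply: (p_vars _ pmon); lia.
- by rewrite comp_endo3 !comp_coordinate !tnth3.
Qed.

(** The cases are whether x_1^d occurs in p. An upper bound is enough in the second, as the value
    only has to stay below q_2. *)
Lemma shift_like_dynamical_degree (R : realType) (k : fieldType) (e : nat)
    (f : endo k 3) : (0 < e)%N -> shift_like f -> degree f = e.+1 ->
  dynamical_degree R f = e.+1%:R \/
  dynamical_degree R f <= quadratic_root R e 1.
Proof.
move=> e0 [p [p_vars ->]]; rewrite degree3 !tdeg_coordinate => fdeg.
(* Since d >= 2, the coordinates cannot account for the degree of f, so p does. *)
have p_deg : tdeg p = e.+1.
  have sdeg : tdeg (p + coordinate k (inord 2)) = e.+1.
    move: fdeg; rewrite addrC maxnn; case: leqP => // _ [e_eq0].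
    by move: e0; rewrite -e_eq0.
  by rewrite -sdeg; apply: tdeg_addr_lt; rewrite sdeg tdeg_coordinate ltnS.
have [pd|pd] := boolP (mnm_muln (mnm1 (inord 0 : 'I_3)) e.+1 \in msupp p).
  left; apply: (@limn_root_eq _ _ 1) => // r.
  by rewrite (shift_like_degree_eq p_vars p_deg)// natrX mul1r lexx.
have m1 : 1 <= quadratic_root R e 1.
  by apply: le_trans (quadratic_root_ge _ _ _); rewrite ler1n.
right; apply: (@limn_root_le _ _ (quadratic_root R e 1)) => [||r].
- exact: lt_le_trans m1.
- exact: le_trans m1.
- by rewrite ler0n (shift_like_degree_le p_vars p_deg)// quadratic_rootE.
Qed.

Lemma gap_endo_dynamical_degree (R : realType) (k : fieldType) (e : nat) :
  (2 <= e)%N -> dynamical_degree R (gap_endo k e) = quadratic_root R e 2.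
Proof.
move=> e2; have m_ge := quadratic_root_ge R e 2.
have mE := quadratic_rootE R e 2.
have e2R : 2 <= e%:R :> R by rewrite ler_nat.
apply: (@limn_root_eq _ _ (2 * e.+1)%:R) => [||r].
- by rewrite ltr0n.
- by lra.
- apply: degree_gap_endo_bounds => //; last by lra.
  by rewrite (le_trans _ m_ge) ?ltW ?quadratic_root_lt//; lra.
Qed.

Theorem corollary4p3p7 (R : realType) (k : fieldType) (d : nat) (hd : (3 <= d)%N) :
  shift_like_dynamical_degrees R k d `<` affine_triangular_dynamical_degrees R k d.
Proof.
case: d hd => // e e2; split=> [_ [f [fA fS fd] <-]|incl].
  by exists f; split=> //; exact: shift_like_affine_triangular.
(* The reverse inclusion would make q_2 the dynamical degree of a shift-like automorphism of degree
   d. *)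
have [f [fA fS fd] fE] : shift_like_dynamical_degrees R k e.+1 (quadratic_root R e 2).
  apply: incl; exists (gap_endo k e); last exact: gap_endo_dynamical_degree.
  split; first exact: automorphism_gap_endo.
    exact: affine_triangular_gap_endo.
  exact: degree_gap_endo.
have := @shift_like_dynamical_degree R k e f (ltnW e2) fS fd.
rewrite fE => -[mE|]; last by rewrite leNgt ltr_quadratic_root.
by have := @quadratic_root_lt R e 2 e2; rewrite mE ltxx.
Qed.
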